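(* The section $s\in H^0(\mathcal A,E)$ defined by the 4D ADHM equations, i.e. $s=(\mu_A,\nu_A,\mu_{A,\overline c},\nu_{A,\overline c})_{A\in\underline{\mathbf 6},\,\overline c\in\overline A}$, is isotropic with respect to the quadratic form $q$ on $E$, that is, $q(s)=0$.
   Context: Work over $\mathbb C$. Let $\underline{\mathbf 6}$ be the set of 2-element subsets of $\{1,2,3,4\}$ and $\underline{\mathbf 3}=\{\{1,2\},\{1,3\},\{2,3\}\}$. For $A\in\underline{\mathbf 6}$ write $A=\{a<b\}$ and let $\overline A=\{\overline a<\overline b\}$ be its complement. Fix $r_A\in\mathbb Z_{\ge0}$ for $A\in\underline{\mathbf 6}$ and $n\ge0$; put $V=\mathbb C^n$, $W_A=\mathbb C^{r_A}$. Let $\mathcal U$ be the open set of tuples $P=(B_a,I_A,J_A)$ in $\bigoplus_{a=1}^4\mathrm{End}(V)\oplus\bigoplus_A(\mathrm{Hom}(W_A,V)\oplus\mathrm{Hom}(V,W_A))$ that are stable, i.e. $\sum_A\mathbb C\langle B_1,\dots,B_4\rangle\cdot I_A(W_A)=V$. The group $G=\mathrm{GL}(n,\mathbb C)$ acts freely on $\mathcal U$ by $g\cdot(B_a,I_A,J_A)=(gB_ag^{-1},gI_A,J_Ag^{-1})$ with smooth quasi-projective quotient $\mathcal A=\mathcal U/G$. The vector bundle $E\to\mathcal A$ is the descent of the trivial bundle on $\mathcal U$ with fibre $$\bigoplus_A\mathrm{End}(V)\oplus\bigoplus_A\mathrm{Hom}(W_A,W_{\overline A})\oplus\bigoplus_{A,\,\overline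 c\in\overline A}(\mathrm{Hom}(W_A,V)\oplus\mathrm{Hom}(V,W_A)),$$ with elements $(P_A,Q_A,R_{A,\overline c},S_{A,\overline c})$ and $G$-action $g\cdot(P_A,Q_A,R_{A,\overline c},S_{A,\overline c})=(gP_Ag^{-1},Q_A,gR_{A,\overline c},S_{A,\overline c}g^{-1})$. The section $s$ is the descent of the $G$-equivariant section whose value at $(B_a,I_A,J_A)$ has components $$\mu_A=[B_a,B_b]+I_AJ_A,\quad\nu_A=J_{\overline A}I_A,\quad\mu_{A,\overline c}=B_{\overline c}I_A,\quad\nu_{A,\overline c}=J_AB_{\overline c}.$$ Let $e_1,\dots,e_4$ be the standard basis of $\mathbb C^4$, $e_A=e_a\wedge e_b$, and identify $\Lambda^4\mathbb C^4\cong\mathbb C$ by $e_1\wedge e_2\wedge e_3\wedge e_4\mapsto1$. The quadratic form $q$ on $E$ is $$q(P_A,Q_A,R_{A,\overline c},S_{A,\overline c})=\sum_{A\in\underline{\mathbf 3}}(\mathrm{tr}(P_AP_{\overline A})-\mathrm{tr}(Q_AQ_{\overline A}))\,e_A\wedge e_{\overline A}+\sum_{A\in\underline{\mathbf 6}}\mathrm{tr}(R_{A,\overline a}S_{A,\overline b}-R_{A,\overline b}S_{A,\overline a})\,e_A\wedge e_{\overline A}.$$ *)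

(* Defs.v *)
From HB Require Import structures.
From mathcomp Require Import all_boot all_order all_algebra.
From mathcomp Require Import generic_quotient.
From mathcomp Require Import boolp reals.
From mathcomp Require Import complex.

Set Implicit Arguments.
Unset Strict Implicit.
Unset Printing Implicit Defensive.

Import GRing.Theory.
Local Open Scope ring_scope.
Local Open Scope quotient_scope.

(* The index set {1,2,3,4} is 'I_4, with a encoded as a - 1. *)
Local Notation i1 := (@Ordinal 4 0 isT).
Local Notation i2 := (@Ordinal 4 1 isT).
Local Notation i3 := (@Ordinal 4 2 isT).

Definition six : finType := {A : {set 'I_4} | #|A| == 2%N}.

Definition elt (A : six) : finType := {c : 'I_4 | c \in val A}.

Lemma cpl_card (A : six) : #|~: val A| == 2%N.
Proof. by rewrite cardsCs setCK card_ord (eqP (valP A)). Qed.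

Definition cpl (A : six) : six := Sub (~: val A) (cpl_card A).

Lemma cplK : involutive cpl.
Proof. by move=> A; apply: val_inj; rewrite /= setCK. Qed.

Definition three : {set six} :=
  [set A : six | val A \in [set [set i1; i2]; [set i1; i3]; [set i2; i3]]].

(* [nth_elt A k] is the k-th element of A in increasing order. *)
Definition nth_elt (A : six) (k : 'I_2) : elt A :=
  let i := cast_ord (esym (eqP (valP A))) k in
  Sub (enum_val i) (enum_valP i).

Definition lo (A : six) : elt A := nth_elt A ord0.
Definition hi (A : six) : elt A := nth_elt A ord_max.

Lemma lo_lt_hi (A : six) : (val (lo A) < val (hi A))%N.
Proof.
have s2 : size (enum (val A)) = 2 by rewrite -cardE (eqP (valP A)).
rewrite /lo /hi /= !(enum_val_nth ord0) /=.
have : sorted ltn (map val (enum (val A))).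
  rewrite {1}/enum_mem -enumT /=.
  apply: (subseq_sorted ltn_trans (map_subseq _ (filter_subseq _ _))).
  by rewrite val_enum_ord.
by case: (enum _) s2 => [|a [|b []]] //= _; rewrite andbT.
Qed.

Lemma lo_hiE (A : six) : val A = [set val (lo A); val (hi A)].
Proof.
apply/esym/eqP; rewrite eqEcard (eqP (valP A)) cards2.
have -> : val (lo A) != val (hi A).
  by apply/eqP => e; have := lo_lt_hi A; rewrite e ltnn.
rewrite andbT; apply/subsetP => c /set2P[] ->; exact: valP.
Qed.

Section ADHM.
Variables (R : realType) (n : nat) (r : six -> nat).
Local Notation C := R[i].

(* V = 'cV[C]_n and W_A = 'cV[C]_(r A); linear maps are matrices acting on
   columns. *)
Record adhm := Adhm {
  adhm_B : 'I_4 -> 'M[C]_n;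
  adhm_I : forall A : six, 'M[C]_(n, r A);
  adhm_J : forall A : six, 'M[C]_(r A, n) }.

HB.instance Definition _ := gen_eqMixin adhm.
HB.instance Definition _ := gen_choiceMixin adhm.

(* Membership in C<B_1, ..., B_4>: a polynomial in noncommuting variables is a
   list of pairs (coefficient, word). *)
Definition in_alg (B : 'I_4 -> 'M[C]_n) (X : 'M[C]_n) : Prop :=
  exists f : seq (C * seq 'I_4), X = \sum_(m <- f) m.1 *: \prod_(a <- m.2) B a.

Definition stable (x : adhm) : Prop :=
  forall v : 'cV[C]_n, exists t : forall A : six, seq ('M[C]_n * 'cV[C]_(r A)),
    (forall A p, p \in t A -> in_alg (adhm_B x) p.1) /\
    v = \sum_(A : six) \sum_(p <- t A) p.1 *m (adhm_I x A *m p.2).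

Definition stable_adhm : choiceType := {x : adhm | `[< stable x >]}.

Definition act (g : 'M[C]_n) (x : adhm) : adhm :=
  Adhm (fun a => g *m adhm_B x a *m invmx g)
       (fun A => g *m adhm_I x A)
       (fun A => adhm_J x A *m invmx g).

Record fibre := Fibre {
  fib_P : six -> 'M[C]_n;
  fib_Q : forall A : six, 'M[C]_(r (cpl A), r A);
  fib_R : forall A : six, elt (cpl A) -> 'M[C]_(n, r A);
  fib_S : forall A : six, elt (cpl A) -> 'M[C]_(r A, n) }.

HB.instance Definition _ := gen_eqMixin fibre.
HB.instance Definition _ := gen_choiceMixin fibre.

Definition fact (g : 'M[C]_n) (f : fibre) : fibre :=
  Fibre (fun A => g *m fib_P f A *m invmx g)
        (fib_Q f)
        (fun A c => g *m fib_R f c)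
        (fun A c => fib_S f c *m invmx g).

Lemma act1 x : act 1%:M x = x.
Proof.
case: x => B I J; rewrite /act /=; congr Adhm.
- by apply/funext => a; rewrite invmx1 mulmx1 mul1mx.
- by apply: functional_extensionality_dep => A; rewrite mul1mx.
- by apply: functional_extensionality_dep => A; rewrite invmx1 mulmx1.
Qed.

Lemma fact1 f : fact 1%:M f = f.
Proof.
case: f => P Q S T; rewrite /fact /=; congr Fibre.
- by apply/funext => a; rewrite invmx1 mulmx1 mul1mx.
- by do 2 apply: functional_extensionality_dep => ?; rewrite mul1mx.
- by do 2 apply: functional_extensionality_dep => ?; rewrite invmx1 mulmx1.
Qed.

Lemma invmxM (g h : 'M[C]_n) : g \in unitmx -> h \in unitmx ->
  invmx (g *m h) = invmx h *m invmx g.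
Proof.
move=> gu hu; have ghu : g *m h \in unitmx by rewrite unitmx_mul gu.
rewrite -[RHS]mulmx1 -(mulmxV ghu) !mulmxA -(mulmxA _ (invmx g)).
by rewrite mulVmx // mulmx1 mulVmx // mul1mx.
Qed.

Lemma actM g h x : g \in unitmx -> h \in unitmx ->
  act (g *m h) x = act g (act h x).
Proof.
move=> gu hu; rewrite /act /= invmxM //; congr Adhm.
- by apply/funext => a; rewrite !mulmxA.
- by apply: functional_extensionality_dep => A; rewrite !mulmxA.
- by apply: functional_extensionality_dep => A; rewrite !mulmxA.
Qed.

Lemma factM g h f : g \in unitmx -> h \in unitmx ->
  fact (g *m h) f = fact g (fact h f).
Proof.
move=> gu hu; rewrite /fact /= invmxM //; congr Fibre.
- by apply/funext => a; rewrite !mulmxA.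
- by do 2 apply: functional_extensionality_dep => ?; rewrite !mulmxA.
- by do 2 apply: functional_extensionality_dep => ?; rewrite !mulmxA.
Qed.

Lemma in_alg_conj g B X : g \in unitmx -> in_alg B X ->
  in_alg (fun a => g *m B a *m invmx g) (g *m X *m invmx g).
Proof.
move=> gu [f ->]; exists f.
rewrite mulmx_sumr mulmx_suml; apply: eq_bigr => m _.
rewrite -scalemxAr -scalemxAl; congr (_ *: _).
elim: m.2 => [|a s IH]; first by rewrite !big_nil mulmx1 mulmxV.
rewrite !big_cons -IH -!mulmxE !mulmxA; congr (_ *m _ *m _).
by rewrite -(mulmxA _ (invmx g)) mulVmx // mulmx1.
Qed.

Lemma act_stable g x : g \in unitmx -> stable x -> stable (act g x).
Proof.
move=> gu sx v; have [t [ta tv]] := sx (invmx g *m v).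
exists (fun A => [seq (g *m p.1 *m invmx g, p.2) | p <- t A]); split.
  by move=> A _ /mapP[p pt ->] /=; apply: in_alg_conj => //; apply: ta pt.
rewrite -[LHS](mulKVmx gu) tv mulmx_sumr; apply: eq_bigr => A _.
rewrite big_map mulmx_sumr; apply: eq_bigr => p _ /=.
by rewrite !mulmxA -(mulmxA _ (invmx g)) mulVmx // mulmx1.
Qed.

(* The orbit relations of G = GL(n, C) on stable_adhm and on stable_adhm x fibre. *)
Definition orbU (x y : stable_adhm) : bool :=
  `[< exists2 g : 'M[C]_n, g \in unitmx & val y = act g (val x) >].

Definition orbE (x y : stable_adhm * fibre) : bool :=
  `[< exists2 g : 'M[C]_n, g \in unitmx &
      val y.1 = act g (val x.1) /\ y.2 = fact g x.2 >].

Lemma orbU_equiv : equiv_class_of orbU.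
Proof.
split.
- by move=> x; apply/asboolP; exists 1%:M; rewrite ?unitmx1 ?act1.
- suff H x y : orbU x y -> orbU y x by move=> x y; apply/idP/idP; apply: H.
  move=> /asboolP[g gu e]; apply/asboolP; exists (invmx g).
    by rewrite unitmx_inv.
  by rewrite e -actM ?unitmx_inv // mulVmx // act1.
- move=> y x z /asboolP[g gu e] /asboolP[h hu e'].
  apply/asboolP; exists (h *m g); first by rewrite unitmx_mul hu.
  by rewrite e' e -actM.
Qed.

Lemma orbE_equiv : equiv_class_of orbE.
Proof.
split.
- by move=> x; apply/asboolP; exists 1%:M; rewrite ?unitmx1 ?act1 ?fact1.
- suff H x y : orbE x y -> orbE y x by move=> x y; apply/idP/idP; apply: H.
  move=> /asboolP[g gu [e f]]; apply/asboolP; exists (invmx g).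
    by rewrite unitmx_inv.
  by rewrite e f -actM ?unitmx_inv // -factM ?unitmx_inv // mulVmx // act1 fact1.
- move=> y x z /asboolP[g gu [e f]] /asboolP[h hu [e' f']].
  apply/asboolP; exists (h *m g); first by rewrite unitmx_mul hu.
  by rewrite e' e f' f -actM // -factM.
Qed.

Canonical orbU_rel := EquivRelPack orbU_equiv.
Canonical orbE_rel := EquivRelPack orbE_equiv.

(* The points of the quotient variety stable_adhm / G and of the total space of E. *)
Definition moduli := {eq_quot orbU}.
Definition bundle := {eq_quot orbE}.

Definition bundle_proj (e : bundle) : moduli := \pi_moduli (repr e).1.

Lemma bundle_projE (x : stable_adhm) (f : fibre) :
  bundle_proj (\pi_bundle (x, f)) = \pi_moduli x.
Proof.
rewrite /bundle_proj; case: piP => y /eqmodP /asboolP[g gu [e _]].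
by apply/esym/eqmodP/asboolP; exists g.
Qed.

Definition adhm_mu (x : adhm) (A : six) : 'M[C]_n :=
  let Ba := adhm_B x (val (lo A)) in let Bb := adhm_B x (val (hi A)) in
  Ba *m Bb - Bb *m Ba + adhm_I x A *m adhm_J x A.

Definition adhm_section (x : adhm) : fibre :=
  Fibre (adhm_mu x)
        (fun A => adhm_J x (cpl A) *m adhm_I x A)
        (fun A c => adhm_B x (val c) *m adhm_I x A)
        (fun A c => adhm_J x A *m adhm_B x (val c)).

Lemma adhm_section_equiv g x : g \in unitmx ->
  adhm_section (act g x) = fact g (adhm_section x).
Proof.
move=> gu; rewrite /adhm_section /fact /=; congr Fibre.
- apply/funext => A; rewrite /adhm_mu /= mulmxDr mulmxBr mulmxDl mulmxBl.
  by rewrite !mulmxA !(mulmxKV gu).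
- by apply: functional_extensionality_dep => A; rewrite mulmxA (mulmxKV gu).
- by do 2 apply: functional_extensionality_dep => ?;
    rewrite !mulmxA (mulmxKV gu).
- do 2 apply: functional_extensionality_dep => ?.
  by rewrite !mulmxA (mulmxKV gu).
Qed.

(* Defined on a representative; [secE] shows independence of the choice. *)
Definition sec (m : moduli) : bundle :=
  \pi_bundle (repr m, adhm_section (val (repr m))).

Lemma secE (x : stable_adhm) :
  sec (\pi_moduli x) = \pi_bundle (x, adhm_section (val x)).
Proof.
rewrite /sec; case: piP => y /eqmodP /asboolP[g gu e].
apply/esym/eqmodP/asboolP; exists g => //=; split=> //.
by rewrite e adhm_section_equiv.
Qed.

Lemma bundle_projK : cancel sec bundle_proj.
Proof. by move=> m; rewrite bundle_projE reprK. Qed.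

(* Under e_1 /\ e_2 /\ e_3 /\ e_4 |-> 1, the identification of the fourth
   exterior power of C^4 with C sends v_1 /\ v_2 /\ v_3 /\ v_4 to the
   determinant of the matrix with rows v_1, ..., v_4. *)
Definition wedge4 (v1 v2 v3 v4 : 'rV[C]_4) : C :=
  \det (\matrix_(i < 4) [tuple v1; v2; v3; v4]`_i).

Definition std (a : 'I_4) : 'rV[C]_4 := delta_mx 0 a.

Definition eAeA' (A : six) : C :=
  wedge4 (std (val (lo A))) (std (val (hi A)))
         (std (val (lo (cpl A)))) (std (val (hi (cpl A)))).

(* Q_(cpl A) is a map W_(cpl A) -> W_(cpl (cpl A)); its codomain is cast to
   W_A. *)
Definition fib_Q' (f : fibre) (A : six) : 'M[C]_(r A, r (cpl A)) :=
  castmx (congr1 r (cplK A), erefl) (fib_Q f (cpl A)).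

Definition q_fibre (f : fibre) : C :=
  \sum_(A in three)
    (\tr (fib_P f A *m fib_P f (cpl A)) - \tr (fib_Q f A *m fib_Q' f A))
    * eAeA' A +
  \sum_(A : six)
    \tr (fib_R f (lo (cpl A)) *m fib_S f (hi (cpl A)) -
         fib_R f (hi (cpl A)) *m fib_S f (lo (cpl A)))
    * eAeA' A.

Lemma q_fibre_inv g f : g \in unitmx -> q_fibre (fact g f) = q_fibre f.
Proof.
move=> gu; rewrite /q_fibre; congr (_ + _); apply: eq_bigr => A _ /=.
  congr ((_ - _) * _); rewrite !mulmxA (mulmxKV gu) -!mulmxA mxtrace_mulC.
  by rewrite -!mulmxA mulVmx // mulmx1.
congr (_ * _); rewrite !mulmxA -!mulmxBl -!(mulmxA g) -mulmxBr mxtrace_mulC.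
by rewrite mulmxA mulVmx // mul1mx.
Qed.

(* Defined on a representative; [quadE] shows independence of the choice. *)
Definition quad (e : bundle) : C := q_fibre (repr e).2.

Lemma quadE (x : stable_adhm) (f : fibre) : quad (\pi_bundle (x, f)) = q_fibre f.
Proof.
rewrite /quad; case: piP => y /eqmodP /asboolP[g gu [_ /= ->]].
by rewrite q_fibre_inv.
Qed.

End ADHM.

(* Main.v *)
(** Cyclicity of the trace makes the terms of [q(s)] that are linear in the
    [I_A J_A] cancel between the two sums of [q], since [e_A /\ e_A'] is
    symmetric under complementation, while [tr (I_A J_A I_A' J_A')] cancels
    against [tr (J_A' I_A J_A I_A')]. What is left is
    [tr ([B_1,B_2][B_3,B_4]) - tr ([B_1,B_3][B_2,B_4]) +
     tr ([B_2,B_3][B_1,B_4])], which vanishes: it is the Jacobi identity paired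
    with [B_4] under the trace form. *)
Require Import Defs.
From mathcomp Require Import all_boot all_order all_algebra.
From mathcomp Require Import perm.
From mathcomp Require Import reals complex.
From mathcomp Require Import ring.

Set Implicit Arguments.
Unset Strict Implicit.
Unset Printing Implicit Defensive.

Import GRing.Theory.
Local Open Scope ring_scope.

Local Notation i1 := (@Ordinal 4 0 isT).
Local Notation i2 := (@Ordinal 4 1 isT).
Local Notation i3 := (@Ordinal 4 2 isT).
Local Notation i4 := (@Ordinal 4 3 isT).

Lemma ord4_cases (P : 'I_4 -> Prop) :
  P i1 -> P i2 -> P i3 -> P i4 -> forall a, P a.
Proof.
move=> P1 P2 P3 P4 [[|[|[|[|//]]]] lt_a4].
- by rewrite (_ : Ordinal _ = i1) //; apply: val_inj.
- by rewrite (_ : Ordinal _ = i2) //; apply: val_inj.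
- by rewrite (_ : Ordinal _ = i3) //; apply: val_inj.
- by rewrite (_ : Ordinal _ = i4) //; apply: val_inj.
Qed.

Lemma lo_hi_pair (A : six) (a b : 'I_4) :
  (a < b)%N -> val A = [set a; b] -> val (lo A) = a /\ val (hi A) = b.
Proof.
move=> ab eA; have lh := lo_lt_hi A.
have : val (hi A) \in val A by exact: valP.
have : val (lo A) \in val A by exact: valP.
move: (val (lo A)) (val (hi A)) lh => l h lh.
rewrite eA => /set2P[] el /set2P[] eh; split=> //.
all: by move: lh; rewrite el eh ?ltnn // => /(ltn_trans ab); rewrite ltnn.
Qed.

Lemma pair_card (a b : 'I_4) : a != b -> #|[set a; b]| == 2%N.
Proof. by rewrite cards2 => ->. Qed.

Definition A12 : six := Sub [set i1; i2] (@pair_card i1 i2 isT).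
Definition A13 : six := Sub [set i1; i3] (@pair_card i1 i3 isT).
Definition A23 : six := Sub [set i2; i3] (@pair_card i2 i3 isT).

Lemma threeE : three = [set A12; A13; A23].
Proof. by apply/setP => A; rewrite !inE -!val_eqE. Qed.

(** Of a pair and its complement exactly one avoids 4, so [three] represents each complementary
    couple once and sums over [six] fold onto it. *)
Lemma mem_three (A : six) : (A \in three) = (i4 \notin val A).
Proof.
apply/idP/idP; first by rewrite threeE !inE => /orP[/orP[]|] /eqP ->; rewrite !inE.
rewrite inE; have := lo_lt_hi A; have := lo_hiE A.
move: (val A) (val (lo A)) (val (hi A)) => _ l h ->.
elim/ord4_cases: l; elim/ord4_cases: h => //= _.
all: by rewrite !inE ?eqxx ?orbT.
Qed.

Lemma cpl_three (A : six) : (cpl A \in three) = (A \notin three).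
Proof. by rewrite !mem_three /= inE. Qed.

Lemma sum_six (V : nmodType) (F : six -> V) :
  \sum_(A : six) F A = \sum_(A in three) (F A + F (cpl A)).
Proof.
rewrite (bigID (mem three)) big_split /=; congr (_ + _).
rewrite (reindex_inj (inv_inj cplK)) /=.
by apply: eq_bigl => A; rewrite cpl_three negbK.
Qed.

Lemma lo_hi_A12 : (val (lo A12) = i1 /\ val (hi A12) = i2) /\
  (val (lo (cpl A12)) = i3 /\ val (hi (cpl A12)) = i4).
Proof.
split; first exact: lo_hi_pair.
by apply: lo_hi_pair => //; apply/setP; elim/ord4_cases; rewrite !inE.
Qed.

Lemma lo_hi_A13 : (val (lo A13) = i1 /\ val (hi A13) = i3) /\
  (val (lo (cpl A13)) = i2 /\ val (hi (cpl A13)) = i4).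
Proof.
split; first exact: lo_hi_pair.
by apply: lo_hi_pair => //; apply/setP; elim/ord4_cases; rewrite !inE.
Qed.

Lemma lo_hi_A23 : (val (lo A23) = i2 /\ val (hi A23) = i3) /\
  (val (lo (cpl A23)) = i1 /\ val (hi (cpl A23)) = i4).
Proof.
split; first exact: lo_hi_pair.
by apply: lo_hi_pair => //; apply/setP; elim/ord4_cases; rewrite !inE.
Qed.

(** After expansion, the twelve words in [a], [b], [c], [d] fall into six cyclic classes, each met
    twice with opposite signs. *)
Lemma mxtrace_comm3 (R : comPzRingType) (n : nat) (a b c d : 'M[R]_n) :
  \tr ((a *m b - b *m a) *m (c *m d - d *m c))
  - \tr ((a *m c - c *m a) *m (b *m d - d *m b))
  + \tr ((b *m c - c *m b) *m (a *m d - d *m a)) = 0.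
Proof.
have rot (x y z w : 'M[R]_n) :
  \tr (x *m y *m z *m w) = \tr (y *m z *m w *m x).
  by rewrite -!mulmxA mxtrace_mulC !mulmxA.
rewrite !mulmxBl !mulmxBr !raddfB /= !mulmxA.
rewrite (rot b a c d) (rot b a d c) (rot c a b d) (rot c a d b).
rewrite (rot b c a d) (rot c a d b) -(rot a b c d) (rot c b a d) (rot b a d c).
rewrite (rot c b d a) (rot b d a c) (rot d a c b).
ring.
Qed.

Section Isotropy.
Variables (R : realType) (n : nat) (r : six -> nat).
Local Notation C := R[i].

(** Permuting the arguments multiplies the matrix of rows on the left by a permutation matrix, whose
    determinant is the sign. *)
Lemma wedge4_perm (v : 'I_4 -> 'rV[C]_4) (s : 'S_4) :
  wedge4 (v (s i1)) (v (s i2)) (v (s i3)) (v (s i4)) =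
  (-1) ^+ s * wedge4 (v i1) (v i2) (v i3) (v i4).
Proof.
rewrite /wedge4 -det_perm -det_mulmx -row_permE; congr (\det _).
apply/matrixP => i j; rewrite !mxE.
have nthv (w : 'I_4 -> 'rV[C]_4) k :
    [:: w i1; w i2; w i3; w i4]`_(val k) = w k.
  by elim/ord4_cases: k.
by rewrite /= nthv (nthv (v \o s)).
Qed.

Lemma eAeA'_cpl (A : six) : eAeA' R (cpl A) = eAeA' R A.
Proof.
rewrite /eAeA' cplK.
set a := std R (val (lo A)); set b := std R (val (hi A)).
set c := std R (val (lo _)); set d := std R (val (hi _)).
(* Two disjoint transpositions, hence an even permutation, take [(a, b, c, d)] to [(c, d, a, b)]. *)
have := wedge4_perm (fun k : 'I_4 => [:: a; b; c; d]`_k)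
  (tperm i1 i3 * tperm i2 i4)%g.
by rewrite odd_mul_tperm odd_tperm /= mul1r !permM !permE /= => ->.
Qed.

Lemma wedge4_std1234 : wedge4 (std R i1) (std R i2) (std R i3) (std R i4) = 1.
Proof.
rewrite /wedge4 -[RHS](det1 C 4); congr (\det _).
apply/matrixP => i j; rewrite !mxE.
by elim/ord4_cases: i; rewrite /= mxE /= eq_sym.
Qed.

Lemma eAeA'_A12 : eAeA' R A12 = 1.
Proof.
by rewrite /eAeA'; case: lo_hi_A12 => [[-> ->] [-> ->]]; rewrite wedge4_std1234.
Qed.

Lemma eAeA'_A13 : eAeA' R A13 = -1.
Proof.
rewrite /eAeA'; case: lo_hi_A13 => [[-> ->] [-> ->]].
have := wedge4_perm (std R) (tperm i2 i3).
by rewrite odd_tperm wedge4_std1234 mulr1 !permE.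
Qed.

Lemma eAeA'_A23 : eAeA' R A23 = 1.
Proof.
rewrite /eAeA'; case: lo_hi_A23 => [[-> ->] [-> ->]].
(* The 3-cycle taking 1, 2, 3 to 2, 3, 1, which is even. *)
have := wedge4_perm (std R) (tperm i1 i2 * tperm i1 i3)%g.
by rewrite odd_mul_tperm odd_tperm wedge4_std1234 mulr1 !permM !permE.
Qed.

Implicit Types x : adhm R n r.

Definition commB x (A : six) : 'M[C]_n :=
  adhm_B x (val (lo A)) *m adhm_B x (val (hi A))
  - adhm_B x (val (hi A)) *m adhm_B x (val (lo A)).

(** The cross term that arises both from [P] and from the pair [R], [S]. *)
Definition trIJ x (A : six) : C :=
  \tr (adhm_I x A *m adhm_J x A *m commB x (cpl A)).

Lemma fib_Q'_section x (A : six) :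
  fib_Q' (adhm_section x) A = adhm_J x A *m adhm_I x (cpl A).
Proof.
(* [cplK A] does not reduce to reflexivity; an arbitrary equality [B = A] can be substituted
   away. *)
have castJ (B : six) (e : B = A) :
    castmx (congr1 r e, erefl) (adhm_J x B *m adhm_I x (cpl A))
    = adhm_J x A *m adhm_I x (cpl A).
  by subst B; rewrite castmx_id.
exact: castJ.
Qed.

Lemma mxtrace_muQ x (A : six) :
  \tr (adhm_mu x A *m adhm_mu x (cpl A))
  - \tr (adhm_J x (cpl A) *m adhm_I x A *m fib_Q' (adhm_section x) A)
  = \tr (commB x A *m commB x (cpl A)) + trIJ x A + trIJ x (cpl A).
Proof.
rewrite fib_Q'_section /trIJ cplK /adhm_mu -!/(commB x _).
move: (commB x A) (commB x (cpl A)) => b b'.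
rewrite mulmxDl !mulmxDr !raddfD /=.
(* Cyclicity identifies the [Q] term with the quartic term [tr (I_A J_A I_A' J_A')] of the
   product. *)
rewrite (mxtrace_mulC b (_ *m _)) -[adhm_J x (cpl A) *m _ *m _]mulmxA.
rewrite (mxtrace_mulC (adhm_J x (cpl A))) !mulmxA.
ring.
Qed.

(** Rotating the leading [B] to the end leaves [I_A J_A] times the complementary commutator in
    reversed order, whence the sign. *)
Lemma mxtrace_RS x (A : six) :
  \tr (adhm_B x (val (lo (cpl A))) *m adhm_I x A
         *m (adhm_J x A *m adhm_B x (val (hi (cpl A))))
       - adhm_B x (val (hi (cpl A))) *m adhm_I x A
         *m (adhm_J x A *m adhm_B x (val (lo (cpl A))))) = - trIJ x A.
Proof.
rewrite /trIJ /commB.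
move: (adhm_B x (val (lo _))) (adhm_B x (val (hi _))) => b b'.
rewrite mulmxBr !raddfB /= -!mulmxA (mxtrace_mulC b) (mxtrace_mulC b') !mulmxA.
by rewrite opprK addrC.
Qed.

Lemma q_fibre_section x : q_fibre (adhm_section x) = 0.
Proof.
rewrite /q_fibre sum_six -big_split /=.
(* [A] and [cpl A] carry the same sign, so both [trIJ] terms cancel between the two sums. *)
under eq_bigr => A _.
  rewrite mxtrace_muQ !mxtrace_RS eAeA'_cpl.
  rewrite (_ : _ + _ = \tr (commB x A *m commB x (cpl A)) * eAeA' R A);
    last by ring.
  over.
have d12_13 : A12 \notin [set A13; A23].
  by apply: contraNN (_ : i3 \notin val A12) => [/set2P[] ->|]; rewrite !inE.
have d13_23 : A13 \notin [set A23].
  by apply: contraNN (_ : i2 \notin val A13) => [/set1P ->|]; rewrite !inE.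
rewrite threeE -setUA big_setU1 //= big_setU1 //= big_set1.
rewrite eAeA'_A12 eAeA'_A13 eAeA'_A23 /commB.
case: lo_hi_A12 => [[-> ->] [-> ->]]; case: lo_hi_A13 => [[-> ->] [-> ->]].
case: lo_hi_A23 => [[-> ->] [-> ->]].
(* The signs 1, -1, 1 are those of [mxtrace_comm3] at [B_1], [B_2], [B_3], [B_4]. *)
by rewrite !mulr1 mulrN1 addrA mxtrace_comm3.
Qed.

End Isotropy.

Theorem proposition2p14 (R : realType) (n : nat) (r : six -> nat) :
  forall m : moduli R n r, quad (sec m) = 0.
Proof. by move=> m; rewrite /sec quadE q_fibre_section. Qed.
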